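(* If $G$ is a finite $2$-group that is realizable in characteristic $0$, then either $\mathbf{C}_2$ or $\mathbf{C}_4$ must be a summand of $G$. Further, the finite abelian $2$-groups of the form $$\mathbf{C}_2\times A\qquad\text{and}\qquad \mathbf{C}_4\times A\times A\times B\times B_2$$ are realizable in characteristic $0$ for any finite abelian $2$-groups $A$ and $B$ (either group may be trivial).
   Context: Rings are associative with identity, not necessarily commutative. A group $G$ is realizable in characteristic $0$ if $G$ is isomorphic to the group of units $R^\times$ of some ring $R$ of characteristic $0$. $\mathbf{C}_m$ denotes the (multiplicative) cyclic group of order $m$. For a finite abelian $2$-group $B$ (written multiplicatively), $B_2=\{x^2 \mid x\in B\}$.
   Formalization: In the first sentence G is taken to be a finite abelian 2-group; for nonabelian G the claim fails, since the Lipschitz quaternions have characteristic 0 and unit group Q_8, which has neither C_2 nor C_4 as a direct factor. *)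

(* Defs.v *)
From HB Require Import structures.
From mathcomp Require Import all_boot all_order all_algebra all_fingroup all_solvable.

Set Implicit Arguments.
Unset Strict Implicit.
Unset Printing Implicit Defensive.

Import GroupScope GRing.Theory.

(* [pchar R] =i pred0 would be too weak: it also holds in 'Z_6. *)
Definition has_char0 (R : unitRingType) : Prop :=
  forall n : nat, (n%:R = 0 :> R)%R -> n = 0%N.

(* The group R^x of an infinite ring is not a finGroupType, so G isog R^x is
   expressed by an injective morphism G -> R whose image is the set of units. *)
Definition isog_units (gT : finGroupType) (G : {set gT}) (R : unitRingType) :
    Prop :=
  exists f : gT -> R,
    [/\ {in G &, {morph f : x y / (x * y)%g >-> (x * y)%R}},
        {in G &, injective f}
      & forall u : R, u \is a GRing.unit <-> exists2 x, x \in G & f x = u].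

Definition realizable_char0 (gT : finGroupType) (G : {set gT}) : Prop :=
  exists R : unitRingType, has_char0 R /\ isog_units G R.

(* For 1 < m, Zp m is all of 'Z_m under addition, i.e. the cyclic group C_m. *)
Definition cyclic_summand (m : nat) (gT : finGroupType) (G : {group gT}) :
    Prop :=
  exists H K : {group gT}, H \x K = G /\ H \isog Zp m.

(* A subgroup when B is abelian; written B_2 in the abelian 2-group setting. *)
Definition squares (gT : finGroupType) (B : {set gT}) : {set gT} :=
  [set x ^+ 2 | x in B].

(* Main.v *)
Require Import Defs.
From HB Require Import structures.
From mathcomp Require Import all_boot all_order all_algebra all_fingroup all_solvable.
From mathcomp Require Import ring zify.

Set Implicit Arguments.
Unset Strict Implicit.
Unset Printing Implicit Defensive.

Import GroupScope GRing.Theory.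

(** If a finite abelian 2-group [G] is the unit group of a ring [R] of
    characteristic 0, look at the height in [G] of the involution [-1].  When
    neither [C_2] nor [C_4] is a summand of [G], every nontrivial cyclic summand
    has order at least 8, so that every involution is a 4th power
    ([abelian_2group_summand_or_fourth_power]).  But [y ^+ 4 = -1] makes
    [s := y - y ^+ 3] a square root of 2, and [1 + s] is then a unit of infinite
    order ([sqrt2_unit_infinite_order]), which [G] has no room for.

    For the constructions, take a ring [S] of characteristic 0 with units [C]
    and an [S]-module [M].  Adjoining [M] to [S] as an ideal of square zero
    keeps the characteristic and makes the unit group [C * M]
    ([realizable_char0_trivial_extension]).  With [S] the integers and [M] the
    group [A] this is [C_2 * A].  With [S] the Gaussian integers, whose units
    form [C_4], a module is an additive group with an endomorphism of square
    [-1]; [A * A] and [B * B_2] both carry one, given by explicit formulas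
    ([realizable_char0_Zp4_squares]). *)

(** * Units of infinite order *)

Lemma char0_natr_inj (R : unitRingType) :
  Defs.has_char0 R -> injective (fun n : nat => n%:R%R : R).
Proof.
move=> charR m n; wlog le_mn : m n / m <= n => [IH | eq_mn].
  by case/orP: (leq_total m n) => /IH // eqE /esym/eqE.
have /charR/eqP: ((n - m)%:R = 0 :> R)%R by rewrite natrB // eq_mn subrr.
by rewrite subn_eq0 => le_nm; apply/eqP; rewrite eqn_leq le_mn.
Qed.

Lemma sqr_neq_double_sqr (m n : nat) : (0 < n -> m ^ 2 <> (n ^ 2).*2)%N.
Proof.
move=> n_gt0 eq_mn; have m_gt0 : (0 < m)%N.
  by rewrite -(@ltn_exp2r 0 m 2) // eq_mn double_gt0 expn_gt0 n_gt0.
have := congr1 (odd \o logn 2) eq_mn.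
by rewrite /= -mul2n lognM ?expn_gt0 ?n_gt0 // !lognX oddD !oddM.
Qed.

Local Open Scope ring_scope.

Lemma expr_1Dsqrt2 (R : nzRingType) (s : R) (n : nat) :
  s ^+ 2 = 2%:R ->
  exists a b : nat, (1 + s) ^+ n.+1 = a.+1%:R + s *+ b.+1.
Proof.
move=> s2; elim: n => [|n [a [b IH]]]; first by exists 0, 0.
exists (a + 2 * b.+1)%N, (b + a.+1)%N; rewrite exprSr IH mulrDr mulr1 mulrDl.
rewrite mulr_natl mulrnAl -expr2 s2 [s *+ _ + _ *+ _]addrC addrACA.
by rewrite -mulrnA -natrD -mulrnDr.
Qed.

(** The ring-theoretic obstruction: [s] is a square root of 2 and
    [(1 + s) * (s - 1) = 1], while the powers of [1 + s] are [a + b * s] with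
    [b > 0], so that [(1 + s) ^+ n = 1] would make 2 a rational square. *)
Lemma sqrt2_unit_infinite_order (R : unitRingType) (s : R) :
    Defs.has_char0 R -> s ^+ 2 = 2%:R ->
  1 + s \is a GRing.unit /\ forall n, (0 < n)%N -> (1 + s) ^+ n <> 1.
Proof.
move=> charR s2; split.
  apply/unitrP; exists (s - 1); rewrite (addrC 1).
  split; first by rewrite -subr_sqr_1 s2 mulr2n addrK.
  by rewrite mulrBr mulrDl mul1r mulr1 -expr2 s2 opprD addrA addrK mulr2n addrK.
case=> // n _; have [a [b ->]] := expr_1Dsqrt2 n s2.
rewrite -[X in X + _]natr1 -[X in _ = X]add0r addrAC => /addIr/eqP.
rewrite addr_eq0 => /eqP/(congr1 (fun x => x ^+ 2)).
rewrite -natrX sqrrN exprMn_n s2 -mulrnA => /(char0_natr_inj charR).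
by rewrite mul2n; apply: sqr_neq_double_sqr.
Qed.

(** As for an 8th root of unity, [- y ^+ 3] is the inverse of [y], and the
    square of [y + y^-1] is [2 + (y ^+ 2 + y ^- 2) = 2]. *)
Lemma sqrt2_of_eighth_root (R : nzRingType) (y : R) :
  y ^+ 4 = -1 -> (y - y ^+ 3) ^+ 2 = 2%:R.
Proof.
move=> y4; rewrite expr2 mulrBl !mulrBr -!exprD -exprS -exprSr -expr2 y4.
by rewrite (exprD y 4 2) y4 mulN1r !opprK opprD opprK addrC addrA subrK.
Qed.

Local Close Scope ring_scope.

(** * Involutions of an abelian 2-group *)

Lemma cyclic_summand_cycle (gT : finGroupType) (G K : {group gT}) (x : gT) :
  <[x]> \x K = G -> cyclic_summand #[x] G.
Proof.
by move=> defG; exists <[x]>%G, K; rewrite isog_sym Zp_isog.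
Qed.

Lemma cyclic_summand_dprod (gT : finGroupType) (G H K : {group gT}) m :
  H \x K = G -> cyclic_summand m K -> cyclic_summand m G.
Proof.
move=> defG [L [M [defK isoL]]]; exists L.
have := defG; rewrite -defK dprodA (dprodC H) -dprodA => defG'.
by have [[_ N _ defN] _ _ _] := dprodP defG'; exists N; rewrite -defN.
Qed.

(** In a cyclic 2-group of order at least 8, the involution is a 4th power;
    this passes to the involutions of any direct sum of such groups.  The
    factors are split off one at a time, as the cyclic group generated by an
    element of maximal order. *)
Lemma abelian_2group_summand_or_fourth_power
    (gT : finGroupType) (G : {group gT}) :
    abelian G -> 2.-group G ->
  [\/ cyclic_summand 2 G, cyclic_summand 4 G
    | forall z, z \in G -> z ^+ 2 = 1 -> exists2 y, y \in G & y ^+ 4 = z].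
Proof.
have [n] := ubnP #|G|; elim: n => // n IHn in G * => /ltnSE leGn cGG pG.
have [G1 | ntG] := eqsVneq G 1.
  constructor 3 => z; rewrite G1 => /set1P-> _.
  by exists 1; rewrite ?set11 ?expg1n.
have [x Gx /esym ox] := exponent_witness (abelian_nil cGG).
have /splitsP[K /complP[tiK defG]] := abelian_splits Gx ox cGG.
have sKG : K \subset G by rewrite -defG mulG_subr.
have {tiK} defG : <[x]> \x K = G.
  by rewrite dprodE // (centSS _ _ cGG) ?cycle_subG.
have [k ox2] := p_natP (mem_p_elt pG Gx).
have x_neq1 : #[x] != 1%N.
  apply: contraNneq ntG => ox1.
  by rewrite trivg_exponent -ox ox1.
case: k ox2 => [|[|[|k]]] ox2.
- by rewrite ox2 in x_neq1.
- by constructor 1; have := cyclic_summand_cycle defG; rewrite ox2.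
- by constructor 2; have := cyclic_summand_cycle defG; rewrite ox2.
have ltKG : #|K| < #|G|.
  rewrite -(dprod_card defG) -orderE ltn_Pmull ?cardG_gt0 // ox2.
  by rewrite (@ltn_exp2l 2 0).
have [] := IHn K (leq_trans ltKG leGn) (abelianS sKG cGG) (pgroupS sKG pG).
- by constructor 1; apply: cyclic_summand_dprod defG _.
- by constructor 2; apply: cyclic_summand_dprod defG _.
move=> rootK; constructor 3 => z Gz z2.
have [_ _ cxK tiK] := dprodP defG.
have [u [v [/cycleP[i ->] Kv defz _]]] := mem_dprod defG Gz.
have cxK' j w : w \in K -> commute (x ^+ j) w.
  by move=> Kw; apply/commute_sym/(centsP cxK); rewrite ?mem_cycle.
have [xi2 v2] : (x ^+ i) ^+ 2 = 1 /\ v ^+ 2 = 1.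
  move: z2; rewrite defz (expgMn _ (cxK' i v Kv)) => xi2v2; have v2: v ^+ 2 = 1.
    apply/set1gP; rewrite -tiK inE (groupX _ Kv) andbT.
    rewrite -(mulKg ((x ^+ i) ^+ 2) (v ^+ 2)) xi2v2 mulg1 groupV.
    by rewrite groupX ?mem_cycle.
  by rewrite -[LHS]mulg1 -[X in _ * X]v2.
have [w Kw wv] := rootK v Kv v2.
(* [x] has order [2 ^ (k + 3)] and [x ^+ (2 * i) = 1], so 4 divides [i]. *)
have /dvdnP[j def_i] : 4 %| i.
  move/eqP: xi2; rewrite -expgM -order_dvdn ox2 (expnSr 2) dvdn_pmul2r //.
  by apply: dvdn_trans; rewrite (@dvdn_exp2l 2 2).
exists (x ^+ j * w); first by rewrite groupM ?groupX // (subsetP sKG).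
by rewrite (expgMn _ (cxK' j w Kw)) -expgM -def_i wv defz.
Qed.

(** The element [-1] of the unit group is an involution.  Were it a 4th power,
    the unit group would contain [1 + sqrt 2], of infinite order. *)
Lemma realizable_char0_cyclic_summand (gT : finGroupType) (G : {group gT}) :
    abelian G -> 2.-group G -> realizable_char0 G ->
  cyclic_summand 2 G \/ cyclic_summand 4 G.
Proof.
move=> cGG pG [R [charR [f [fM f_inj fU]]]].
have [|| rootG] := abelian_2group_summand_or_fourth_power cGG pG; try tauto.
have unit_f x : x \in G -> f x \is a GRing.unit.
  by move=> Gx; apply/fU; exists x.
have f1 : f 1 = 1%R.
  by apply: (mulrI (unit_f 1 (group1 G))); rewrite -fM // mulg1 mulr1.
have fX x n : x \in G -> f (x ^+ n) = (f x ^+ n)%R.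
  move=> Gx; elim: n => [|n IHn]; first by rewrite expr0.
  by rewrite expgS exprS -IHn fM ?groupX.
have /fU[z Gz fz] : (-1 : R)%R \is a GRing.unit by rewrite unitrN1.
have z2 : z ^+ 2 = 1.
  by apply: f_inj; rewrite ?groupX ?group1 // fX // fz sqrrN f1 expr1n.
have [y Gy y4] := rootG z Gz z2.
have fy4 : (f y ^+ 4 = -1)%R by rewrite -fX // y4.
have [/fU[u Gu fu]] :=
  sqrt2_unit_infinite_order charR (sqrt2_of_eighth_root fy4).
move/(_ #|G| (cardG_gt0 G)); case.
by rewrite -fu -fX // expg_cardG.
Qed.

(** * Trivial extensions *)

(** The commutativity proof is a parameter of the type, so that the additive
    structure can be inferred from it. *)
Definition additive_of (gT : finGroupType) (A : {group gT})
  of abelian A : Type := subg_of A.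

Section AdditiveOf.

Variables (gT : finGroupType) (A : {group gT}) (cAA : abelian A).

Let subg_mulC : commutative (@mulg (subg_of A)).
Proof.
by move=> x y; apply: val_inj; apply: (centsP cAA); apply: valP.
Qed.

HB.instance Definition _ := Choice.copy (additive_of cAA) (subg_of A).
HB.instance Definition _ := GRing.isZmodule.Build (additive_of cAA)
  (@mulgA (subg_of A)) subg_mulC (@mul1g (subg_of A)) (@mulVg (subg_of A)).

End AdditiveOf.

(** The ring obtained from [S] by adjoining [M] as an ideal of square zero; also
    called the idealization of [M], or its Nagata extension. *)
Definition trivial_extension (S : comUnitRingType) (M : lmodType S) : Type :=
  (S * M)%type.

Section TrivialExtension.

Variables (S : comUnitRingType) (M : lmodType S).
Local Notation T := (trivial_extension M).
Local Open Scope ring_scope.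

HB.instance Definition _ := GRing.Zmodule.copy T (S * M)%type.

Implicit Types x y z : T.

Let tmul x y : T := (x.1 * y.1, x.1 *: y.2 + y.1 *: x.2).

Let tmulA : associative tmul.
Proof.
move=> x y z; congr (_, _) => /=; first exact: mulrA.
by rewrite !scalerDr !scalerA addrA [z.1 * x.1]mulrC [z.1 * y.1]mulrC mulrC.
Qed.

Let tmulC : commutative tmul.
Proof. by move=> x y; congr (_, _) => /=; rewrite ?[x.1 * _]mulrC // addrC. Qed.

Let tmul1 : left_id ((1, 0) : T) tmul.
Proof. by case=> s m; rewrite /tmul /= mul1r scale1r scaler0 addr0. Qed.

Let tmulDl : left_distributive tmul +%R.
Proof.
move=> x y z; congr (_, _) => /=; first exact: mulrDl.
by rewrite scalerDl scalerDr addrACA.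
Qed.

Let tone_neq0 : ((1, 0) : T) != 0.
Proof. by apply/eqP=> -[/eqP]; rewrite oner_eq0. Qed.

HB.instance Definition _ :=
  GRing.Zmodule_isComNzRing.Build T tmulA tmulC tmul1 tmulDl tone_neq0.

Let tunit : {pred T} := [pred x | x.1 \is a GRing.unit].
Let tinv x : T := if x \in tunit then (x.1^-1, - (x.1^-1 ^+ 2 *: x.2)) else x.

Let tmulV : {in tunit, left_inverse 1 tinv *%R}.
Proof.
move=> x Ux; rewrite /tinv Ux; congr (_, _) => /=; first exact: mulVr.
by rewrite scalerN scalerA expr2 mulrA mulrV // mul1r subrr.
Qed.

Let tunitP x y : y * x = 1 -> tunit x.
Proof. by move=> [yx1 _]; apply/unitrPr; exists y.1; rewrite mulrC. Qed.

Let tinv_out : {in [predC tunit], tinv =1 id}.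
Proof. by move=> x Ux; rewrite /tinv ifN. Qed.

HB.instance Definition _ :=
  GRing.ComNzRing_hasMulInverse.Build T tmulV tunitP tinv_out.

Lemma trivial_extension_mulE x y :
  x * y = (x.1 * y.1, x.1 *: y.2 + y.1 *: x.2) :> T.
Proof. by []. Qed.

Lemma trivial_extension_unitE x : (x \is a GRing.unit) = (x.1 \is a GRing.unit).
Proof. by []. Qed.

Lemma trivial_extension_char0 : Defs.has_char0 S -> Defs.has_char0 T.
Proof.
move=> charS n n0; apply: charS.
by rewrite -[RHS]/(0 : T).1 -n0 (raddfMn (@fst S M)).
Qed.

End TrivialExtension.

(** The units of the trivial extension are the [u * (1 + m)] with [u] a unit of
    [S], and [1 + m] multiplies by adding the [m]: they form the direct product
    of the units of [S] and the additive group of [M]. *)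
Lemma realizable_char0_trivial_extension
    (S : comUnitRingType) (M : lmodType S) (cT hT : finGroupType)
    (C : {set cT}) (H : {set hT}) (psi : hT -> M) :
    Defs.has_char0 S -> isog_units C S ->
    {in H &, {morph psi : x y / (x * y)%g >-> (x + y)%R}} ->
    {in H &, injective psi} -> (forall m, exists2 x, x \in H & psi x = m) ->
  realizable_char0 (setX C H).
Proof.
move=> charS [f [fM f_inj fU]] psiD psi_inj psi_onto.
have unit_f c : c \in C -> f c \is a GRing.unit.
  by move=> Cc; apply/fU; exists c.
exists (trivial_extension M); split; first exact: trivial_extension_char0.
(* [(f c, f c *: psi h)] is the product of [f c] and [1 + psi h]. *)
exists (fun x => (f x.1, f x.1 *: psi x.2)%R).
split=> [[c h] [d k]|[c h] [d k]|[u m]].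
- case/setXP=> /= Cc Hh /setXP[/= Cd Hk].
  rewrite trivial_extension_mulE /= fM // psiD //.
  by rewrite scalerDr !scalerA [(f d * _)%R]mulrC [(_ + _)%R]addrC.
- case/setXP=> /= Cc Hh /setXP[/= Cd Hk] [/f_inj-> //].
  move/(congr1 ( *:%R (f d)^-1)); rewrite !scalerA mulVr ?unit_f // !scale1r.
  by move/psi_inj->.
rewrite trivial_extension_unitE /=; split=> [Uu | [[c h]]].
  have [c Cc fc] := (fU u).1 Uu; have [h Hh psih] := psi_onto (u^-1 *: m)%R.
  exists (c, h); first by rewrite inE Cc.
  by rewrite /= fc psih scalerA mulrV // scale1r.
by case/setXP=> /= Cc _ [<- _]; apply: unit_f.
Qed.

Lemma isog_units_Zp_primitive_root (R : unitRingType) (n : nat) (z : R) :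
    (n.+2.-primitive_root z)%R ->
    (forall u : R, u \is a GRing.unit -> exists k : nat, u = (z ^+ k)%R) ->
  isog_units (Zp n.+2) R.
Proof.
move=> prim_z unit_z; exists (fun k : 'Z_n.+2 => z ^+ k)%R; split.
- by move=> k l _ _; rewrite -exprD -(prim_expr_mod prim_z (k + l)).
- move=> k l _ _ /eqP; rewrite (eq_prim_root_expr prim_z) !modn_small //.
  by move/eqP/val_inj.
move=> u; split=> [/unit_z[k ->] | [k _ <-]].
  by exists (inZp k : 'Z_n.+2); rewrite ?inE //= prim_expr_mod.
by rewrite unitrX // -(unitrX_pos z (ltn0Sn n.+1)) prim_expr_order ?unitr1.
Qed.

(** Over the integers, every additive group is a module and the units are
    [1] and [-1]. *)
Lemma realizable_char0_Zp2 (gT : finGroupType) (A : {group gT}) :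
  abelian A -> realizable_char0 (setX (Zp 2) A).
Proof.
move=> cAA; pose M : lmodType int := zmodule (additive_of cAA).
apply: (@realizable_char0_trivial_extension int M _ _ _ _ (subg A)).
- by move=> n; rewrite natz => -[].
- apply: (@isog_units_Zp_primitive_root int 0 (-1)%R).
    apply/andP; split=> //; apply/forallP.
    by move=> -[[|[|//]] ?]; rewrite unity_rootE.
  by move=> u /orP[] /eqP->; [exists 0%N | exists 1%N].
- exact: subgM.
- by move=> x y Ax Ay /(congr1 sgval); rewrite !subgK.
by move=> m; exists (sgval m); [apply: valP | apply: sgvalK].
Qed.

(** * Gaussian integers *)

(** The pair [(a, b)] stands for [a + b i]. *)
Definition gaussint : Type := (int * int)%type.

Section GaussInt.

Local Open Scope ring_scope.
Import Num.Theory.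
Implicit Types x y z : gaussint.

HB.instance Definition _ := GRing.Zmodule.copy gaussint (int * int)%type.

Let gmul x y : gaussint := (x.1 * y.1 - x.2 * y.2, x.1 * y.2 + x.2 * y.1).

Let gmulA : associative gmul.
Proof. by move=> x y z; congr (_, _) => /=; ring. Qed.

Let gmulC : commutative gmul.
Proof. by move=> x y; congr (_, _); ring. Qed.

Let gmul1 : left_id ((1, 0) : gaussint) gmul.
Proof. by case=> a b; congr (_, _) => /=; ring. Qed.

Let gmulDl : left_distributive gmul +%R.
Proof. by move=> x y z; congr (_, _) => /=; ring. Qed.

Let gone_neq0 : ((1, 0) : gaussint) != 0.
Proof. by []. Qed.

HB.instance Definition _ :=
  GRing.Zmodule_isComNzRing.Build gaussint gmulA gmulC gmul1 gmulDl gone_neq0.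

Definition gnorm x : int := x.1 ^+ 2 + x.2 ^+ 2.

Lemma gnormM x y : gnorm (x * y) = gnorm x * gnorm y.
Proof. by rewrite /gnorm /=; ring. Qed.

Let gunit : {pred gaussint} := [pred x | gnorm x == 1].
Let ginv x : gaussint := if x \in gunit then (x.1, - x.2) else x.

Let gmulV : {in gunit, left_inverse 1 ginv *%R}.
Proof.
move=> x Ux; rewrite /ginv Ux; congr (_, _) => /=; last by ring.
by rewrite -(eqP Ux) /gnorm; ring.
Qed.

Let gunitP x y : y * x = 1 -> gunit x.
Proof.
move/(congr1 gnorm); rewrite gnormM -[RHS]/(1 : int) => /intUnitRing.unitzPl.
case/orP=> // /eqP x_neg; suff: 0 <= gnorm x by rewrite x_neg.
by rewrite addr_ge0 ?sqr_ge0.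
Qed.

Let ginv_out : {in [predC gunit], ginv =1 id}.
Proof. by move=> x Ux; rewrite /ginv ifN. Qed.

HB.instance Definition _ :=
  GRing.ComNzRing_hasMulInverse.Build gaussint gmulV gunitP ginv_out.

Lemma gaussint_mulE x y :
  x * y = (x.1 * y.1 - x.2 * y.2, x.1 * y.2 + x.2 * y.1) :> gaussint.
Proof. by []. Qed.

Definition gauss_i : gaussint := (0, 1).

Lemma gauss_i_primitive : 4.-primitive_root gauss_i.
Proof.
apply/andP; split=> //; apply/forallP.
by move=> -[[|[|[|[|//]]]] ?]; rewrite unity_rootE.
Qed.

Lemma gaussint_unit x : x \is a GRing.unit -> exists k, x = gauss_i ^+ k.
Proof.
case: x => a b /eqP; rewrite /= /gnorm /= !expr2 => ab1.
have a_small : [|| a == 0, a == 1 | a == -1] by nia.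
have b_small : [|| b == 0, b == 1 | b == -1] by nia.
move: ab1; case/or3P: a_small => /eqP->; case/or3P: b_small => /eqP-> // _.
- by exists 1%N.
- by exists 3%N.
- by exists 0%N.
- by exists 2%N.
Qed.

Lemma gaussint_char0 : Defs.has_char0 gaussint.
Proof.
move=> n n0; suff: n%:R = 0 :> int by rewrite natz => -[].
by rewrite -[RHS]/(0 : gaussint).1 -n0 (raddfMn (@fst int int)).
Qed.

End GaussInt.

(** An additive group with an endomorphism [J] of square [-1] is a module over
    the Gaussian integers, [i] acting as [J]; [J] is a parameter of the type so
    that the scaling can be inferred from it. *)
Definition gauss_module (M : zmodType) (J : {additive M -> M})
  of (forall m, J (J m) = - m)%R : Type := M.

Section GaussModule.

Local Open Scope ring_scope.
Variables (M : zmodType) (J : {additive M -> M}).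
Hypothesis JJ : forall m, J (J m) = - m.
Local Notation V := (gauss_module JJ).

HB.instance Definition _ := GRing.Zmodule.copy V M.

Let gscale (x : gaussint) (m : V) : V := m *~ x.1 + J m *~ x.2.

Let gscaleA x y m : gscale x (gscale y m) = gscale (x * y) m.
Proof.
rewrite /gscale gaussint_mulE /= raddfD !raddfMz JJ.
rewrite !mulrzDl mulrzBr mulrzDr -!mulrzA !mulNrz !(mulrC x.1) !(mulrC x.2).
by rewrite [X in _ + X = _]addrC addrACA.
Qed.

Let gscale1 : left_id 1 gscale.
Proof. by move=> m; rewrite /gscale mulr1z mulr0z addr0. Qed.

Let gscaleDr : right_distributive gscale +%R.
Proof. by move=> x m n; rewrite /gscale raddfD !mulrzDl addrACA. Qed.

Let gscaleDl m : {morph gscale^~ m : x y / x + y}.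
Proof. by move=> x y; rewrite /gscale !mulrzDr addrACA. Qed.

HB.instance Definition _ :=
  GRing.Zmodule_isLmodule.Build gaussint V gscaleA gscale1 gscaleDr gscaleDl.

End GaussModule.

(** An automorphism [j] of [H] whose square is inversion makes [H] a module
    over the Gaussian integers, whose units are the powers of [i]. *)
Lemma realizable_char0_Zp4 (gT : finGroupType) (H : {group gT}) (j : gT -> gT) :
    abelian H -> {in H, forall x, j x \in H} ->
    {in H &, {morph j : x y / x * y}} -> {in H, forall x, j (j x) = x^-1} ->
  realizable_char0 (setX (Zp 4) H).
Proof.
move=> cHH jH jM jj.
pose J (m : additive_of cHH) : additive_of cHH := subg H (j (sgval m)).
have J_add : {morph J : m n / (m + n)%R}.
  by move=> m n; rewrite /J jM ?subgP // subgM ?jH ?subgP.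
have J_monoid : nmod_morphism J.
  by split=> //; apply: (addrI (J 0%R)); rewrite -J_add !addr0.
pose J' : {additive additive_of cHH -> additive_of cHH} :=
  HB.pack J (GRing.isNmodMorphism.Build _ _ J J_monoid).
have JJ m : (J' (J' m) = - m)%R.
  by apply: val_inj; rewrite /= /J !subgK ?jH ?subgP // jj ?subgP.
pose M : lmodType gaussint := gauss_module JJ.
apply: (@realizable_char0_trivial_extension _ M _ _ _ _ (subg H)).
- exact: gaussint_char0.
- exact: isog_units_Zp_primitive_root gauss_i_primitive gaussint_unit.
- exact: subgM.
- by move=> x y Hx Hy /(congr1 sgval); rewrite !subgK.
by move=> m; exists (sgval m); [apply: valP | apply: sgvalK].
Qed.

(** * Construction of the groups with a factor of order 4 *)

Lemma realizable_char0_isog (gT hT : finGroupType) (G : {set gT}) (H : {set hT})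
    (h : gT -> hT) :
    {in G &, {morph h : x y / x * y}} -> {in G &, injective h} -> h @: G = H ->
  realizable_char0 H -> realizable_char0 G.
Proof.
move=> hM h_inj <- [R [charR [f [fM f_inj fU]]]]; exists R; split=> //.
have hG := imset_f h; exists (f \o h); split=> [x y Gx Gy | x y Gx Gy | u].
- by rewrite /= hM // fM ?hG.
- by move/f_inj => /(_ (hG _ _ Gx) (hG _ _ Gy)); apply: h_inj.
rewrite fU; split=> [[_ /imsetP[x Gx ->] <-] | [x Gx <-]]; first by exists x.
by exists (h x); rewrite ?hG.
Qed.

Lemma squares_group_set (gT : finGroupType) (B : {group gT}) :
  abelian B -> group_set (squares B).
Proof.
move=> cBB; apply/group_setP; split.
  by apply/imsetP; exists 1; rewrite ?expg1n.
move=> _ _ /imsetP[x Bx ->] /imsetP[y By ->]; apply/imsetP.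
by exists (x * y); rewrite ?groupM // expgMn //; apply: (centsP cBB).
Qed.

Lemma squares_sub (gT : finGroupType) (B : {group gT}) : squares B \subset B.
Proof. by apply/subsetP=> _ /imsetP[x Bx ->]; rewrite groupX. Qed.

Lemma abelian_setX (aT bT : finGroupType) (A : {set aT}) (B : {set bT}) :
  abelian A -> abelian B -> abelian (setX A B).
Proof.
move=> /centsP cAA /centsP cBB; apply/centsP=> -[a b] /setXP[Aa Bb] [c d].
by move=> /setXP[Ac Bd]; congr (_, _); [apply: cAA | apply: cBB].
Qed.

(** On [A * A * (B * B_2)] the automorphism
    [(a, a', b, s) |-> (a'^-1, a, (b s)^-1, b^2 s)] squares to inversion.  On
    [A * A] this is multiplication by [i] on the tensor product of [A] with the
    Gaussian integers.  On [B * B_2] it is modelled on the cyclic [B] of order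
    [2 ^ k], where it is multiplication by [i] on the quotient of the Gaussian
    integers by [(1 + i) ^ (2 k - 1)], in the basis [1, 1 + i], of orders
    [2 ^ k] and [2 ^ (k - 1)], the class of [y (1 + i)] being represented by
    the element [2 y] of [B_2]. *)
Lemma realizable_char0_Zp4_squares
    (aT bT : finGroupType) (A : {group aT}) (B : {group bT}) :
    abelian A -> abelian B ->
  realizable_char0 (setX (setX (setX (setX (Zp 4) A) A) B) (squares B)).
Proof.
move=> cAA cBB; pose B2 := Group (squares_group_set cBB).
have sB2 : {subset B2 <= B} by apply/subsetP/squares_sub.
have cAB : abelian (setX (setX (setX A A) B) B2).
  by rewrite !abelian_setX // (abelianS (squares_sub B)).
have B2sqr x : x \in B -> x ^+ 2 \in B2 by move=> Bx; apply/imset_f.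
have cB x y : x \in B -> y \in B -> x * y = y * x.
  by move=> Bx By; apply: (centsP cBB).
have swapB w x y z : x \in B -> y \in B -> w * x * (y * z) = w * y * (x * z).
  by move=> Bx By; rewrite -!mulgA (mulgA x) (cB x y) // -mulgA.
pose j (t : aT * aT * bT * bT) :=
  (t.1.1.2^-1, t.1.1.1, (t.1.2 * t.2)^-1, t.1.2 ^+ 2 * t.2).
have jP : realizable_char0 (setX (Zp 4) (setX (setX (setX A A) B) B2)).
  apply: (realizable_char0_Zp4 (j := j)) => //.
  - move=> [[[a a'] b] s] /setXP[/setXP[/setXP[/= Aa Aa'] Bb] Ss].
    have B2bs : b ^+ 2 * s \in squares B by apply: (groupM (B2sqr _ Bb) Ss).
    apply/setXP; split=> //=.
    by rewrite !in_setX /= !groupV Aa' Aa groupM ?(sB2 s).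
  - move=> [[[a a'] b] s] [[[c c'] d] t].
    move=> /setXP[/setXP[/setXP[/= Aa Aa'] Bb] Ss].
    move=> /setXP[/setXP[/setXP[/= Ac Ac'] Bd] St].
    have [Bs Bt] := (sB2 _ Ss, sB2 _ St).
    congr (_, _, _, _) => /=.
    + by rewrite invMg; apply: (centsP cAA); rewrite groupV.
    + by rewrite swapB // invMg (cB (d * t)^-1) ?groupV ?groupM.
    by rewrite (expgMn _ (cB b d Bb Bd)) swapB ?groupX.
  move=> [[[a a'] b] s] /setXP[/setXP[/setXP[/= Aa Aa'] Bb] Ss].
  have Bs := sB2 _ Ss; congr (_, _, _, _) => /=.
    by rewrite expgS expg1 -mulgA (cB b (b * s)) ?groupM // mulKg.
  rewrite expgVn (expgMn _ (cB b s Bb Bs)) invMg -mulgA mulKg.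
  by rewrite expgS expg1 invMg mulgKV.
(* The two sides differ by the bracketing of the direct product. *)
pose reassoc (t : 'Z_4 * aT * aT * bT * bT) :=
  (t.1.1.1.1, (t.1.1.1.2, t.1.1.2, t.1.2, t.2)).
apply: (realizable_char0_isog (h := reassoc)) jP => //.
  by move=> [[[[z a] a'] b] s] [[[[z' c] c'] d] t] _ _ [-> -> -> -> ->].
apply/setP=> -[z [[[a a'] b] s]]; apply/imsetP/idP.
  case=> -[[[[z' c] c'] d] t]; rewrite !in_setX /= -!andbA => in_GT.
  by case=> -> -> -> -> ->.
rewrite !in_setX /= !andbA => in_ZH; exists (z, a, a', b, s) => //.
by rewrite !in_setX.
Qed.

Theorem theorem1p3 :
  (forall (gT : finGroupType) (G : {group gT}),
     abelian G -> 2.-group G -> realizable_char0 G ->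
     cyclic_summand 2 G \/ cyclic_summand 4 G)
  /\
  (forall (aT : finGroupType) (A : {group aT}),
     abelian A -> 2.-group A ->
     realizable_char0 (setX (Zp 2) A))
  /\
  (forall (aT bT : finGroupType) (A : {group aT}) (B : {group bT}),
     abelian A -> 2.-group A -> abelian B -> 2.-group B ->
     realizable_char0
       (setX (setX (setX (setX (Zp 4) A) A) B) (squares B))).
Proof.
split; first exact: realizable_char0_cyclic_summand.
split=> [aT A cAA _ | aT bT A B cAA _ cBB _].
  exact: realizable_char0_Zp2.
exact: realizable_char0_Zp4_squares.
Qed.
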